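(* Let $n\ge 1$, $k\ge 0$, $d\ge \max(k,1)$ and $s\geq n+1$ be integers, and put $j=2$ if $s\geq n+2$ and $j=1$ if $s=n+1$. Assume $d<k+1+j\,\frac{k+1}{n}$. Then $O_{k,n,d}^s$ is not defective and $O_{k,n,d}^s=\mathbb{P}^N$, where $N=\binom{n+d}{n}-1$.
   Context: Let $K$ be an algebraically closed field of characteristic $0$, $R=K[x_0,\dots,x_n]$, $R_d$ the space of forms of degree $d$, $N=\binom{n+d}{n}-1$ and $\mathbb{P}^N=\mathbb{P}(R_d)$. The Veronese variety is $X_{n,d}=\{[L^d] : L\in R_1\setminus\{0\}\}\subset\mathbb{P}^N$. For $d\ge k\ge 0$, its $k$-th osculating variety (the closure of the union of the linear spans of the $k$-th infinitesimal neighbourhoods of points of $X_{n,d}$) is $O_{k,n,d}=\{[L^{d-k}F] : L\in R_1\setminus\{0\},\ F\in R_k\setminus\{0\}\}$. $O_{k,n,d}^s$ denotes the closure of the union of all linear spaces spanned by $s$ points of $O_{k,n,d}$; equivalently the closure of the set of classes of forms $L_1^{d-k}F_1+\dots+L_s^{d-k}F_s$ with $L_i\in R_1$, $F_i\in R_k$. Its expected dimension is $\operatorname{expdim} O_{k,n,d}^s=\min\{N,\ s\binom{k+n}{n}+sn-1\}$; it is called defective if $\dim O_{k,n,d}^s<\operatorname{expdim} O_{k,n,d}^s$. *)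

(* Defs.v *)
From HB Require Import structures.
From mathcomp Require Import all_boot all_order all_algebra.
From mathcomp Require Import boolp classical_sets.
From mathcomp Require Import mpoly.

Set Implicit Arguments.
Unset Strict Implicit.
Unset Printing Implicit Defensive.

Import GRing.Theory.

Local Open Scope classical_set_scope.
Local Open Scope ring_scope.

(* The projective space P(V) of lines through the origin of V. *)
Definition proj (K : fieldType) (V : vectType K) : Type :=
  {U : {vspace V} | \dim U == 1%N}.

(* Zariski topology on P(V).  Polynomial functions on V are taken in the
   coordinates given by some basis of V; a change of basis permutes the
   homogeneous polynomials of each degree, so the closed sets do not depend on
   this choice. *)
Section Zariski.
Variables (K : fieldType) (V : vectType K).

Definition peval (f : {mpoly K[\dim {:V}]}) (v : V) : K :=
  f.@[fun i => coord (vbasis {:V}) i v].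

Definition zero_locus (S : set {mpoly K[\dim {:V}]}) : set (proj V) :=
  [set p : proj V | forall f, S f -> forall v, v \in val p -> peval f v = 0].

Definition zclosed (Z : set (proj V)) : Prop :=
  exists S : set {mpoly K[\dim {:V}]},
    (forall f, S f -> exists e, f \is e.-homog) /\ Z = zero_locus S.

Definition zclosure (A : set (proj V)) : set (proj V) := smallest zclosed A.

Definition zirreducible (Z : set (proj V)) : Prop :=
  Z !=set0 /\
  forall Z1 Z2, zclosed Z1 -> zclosed Z2 ->
    Z `<=` Z1 `|` Z2 -> Z `<=` Z1 \/ Z `<=` Z2.

(* Z 0 < Z 1 < ... < Z l, all of them closed, irreducible and inside X *)
Definition irreducible_chain (X : set (proj V)) (l : nat)
    (Z : nat -> set (proj V)) : Prop :=
  (forall i, (i <= l)%N -> [/\ zclosed (Z i), zirreducible (Z i) & Z i `<=` X])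
  /\ (forall i, (i < l)%N -> Z i `<` Z i.+1).

(* dim X < m, where dim X is the supremum of the lengths of the chains of
   irreducible closed subsets of X *)
Definition dim_lt (X : set (proj V)) (m : nat) : Prop :=
  forall l Z, irreducible_chain X l Z -> (l < m)%N.

(* Closure of the union of the linear spaces spanned by s points of X.  Repeated
   points are allowed. *)
Definition secant_variety (s : nat) (X : set (proj V)) : set (proj V) :=
  zclosure [set p : proj V | exists q : 'I_s -> proj V,
    (forall i, X (q i)) /\ (val p <= \sum_(i < s) val (q i))%VS].

End Zariski.

Section Osculating.
Variables (K : fieldType) (k n d : nat).

(* The class of a form G is the line <[G]>; the product L ^+ (d - k) * F is taken
   in the polynomial ring and has degree d when k <= d. *)
Definition osculating : set (proj (dhomog n.+1 K d)) :=
  [set p : proj (dhomog n.+1 K d) |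
   exists (L : dhomog n.+1 K 1) (F : dhomog n.+1 K k) (G : dhomog n.+1 K d),
     [/\ L != 0, F != 0,
         (G : {mpoly K[n.+1]})
           = (L : {mpoly K[n.+1]}) ^+ (d - k) * (F : {mpoly K[n.+1]})
       & val p = <[G]>%VS]].

Definition osculating_secant (s : nat) :
    set (proj (dhomog n.+1 K d)) :=
  secant_variety s osculating.

Definition expdim (s : nat) : nat :=
  minn ('C(n + d, n) - 1) (s * 'C(k + n, n) + s * n - 1).

Definition defective (s : nat) : Prop :=
  dim_lt (osculating_secant s) (expdim s).

End Osculating.

Arguments osculating : clear implicits.
Arguments osculating_secant : clear implicits.
Arguments defective : clear implicits.

(* Main.v *)
Require Import Defs.
From HB Require Import structures.
From mathcomp Require Import all_boot all_order all_algebra.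
From mathcomp Require Import boolp classical_sets.
From mathcomp Require Import mpoly.
From mathcomp Require Import ring zify.

(* Take the linear forms X_0, ..., X_n and, when s >= n + 2, also
   ell = X_0 + ... + X_n, and put a = d - k.  Every form of degree d lies in
   the ideal of the a-th powers of these forms, so every point of P^N lies on
   an honest s-secant space and no closure is needed.  For s = n + 1 this is
   the pigeonhole principle on exponents.  For s >= n + 2 it is the
   surjectivity of ell^a : A_k -> A_d for A = K[X]/(X_i^a), i.e. Stanley's
   strong Lefschetz property: E = ell * _ and F = sum_i d_i (a - X_i d_i) act
   on A with [E, F] = 2 deg - (n + 1)(a - 1); if E v = 0 in A then E^r F^r v is
   a nonzero multiple of v, and the general case follows by descending
   induction on the degree, since E v = E^(r+1) z makes E kill v - E^r z.
   Non-defectivity follows from a full flag of linear subspaces of P^N. *)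

Import Order.TTheory GRing.Theory Num.Theory.

Local Open Scope ring_scope.

(** The sl2 commutator for one pair of variables, a consequence of the Leibniz rule; it is used with
    [D] = d_i, [x] = X_i, [y] = X_j and [c] the Kronecker delta. *)
Lemma derivation_commutator (R : comNzRingType) (D : {additive R -> R})
    (hD : forall u v, D (u * v) = D u * v + u * D v) (a : nat) (x y c p : R) :
  D y = c -> D x = 1 -> D c = 0 ->
  y * D (p *+ a - x * D p) - D ((y * p) *+ a - x * D (y * p)) =
    c * ((x * D p) *+ 2 - p *+ a + p).
Proof.
move=> Dy Dx Dc.
rewrite (hD y) Dy !raddfB !raddfMn !hD !raddfD !hD Dx Dy Dc /=.
ring.
Qed.

(** * The ideal of the a-th powers of the variables *)

Section Lefschetz.
Variables (K : fieldType) (N : nat).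
Implicit Types (p q v : {mpoly K[N]}) (m : 'X_{1..N}) (i j : 'I_N).

Lemma mcoeffXUM i p m :
  ('X_i * p)@_m = if m i == 0%N then 0 else p@_(m - U_(i)).
Proof.
rewrite mulrC; case: eqP => [mi0|/eqP mi].
  apply/eqP; rewrite mcoeff_eq0 (perm_mem (msuppMX _ _)).
  by apply/mapP => -[m' _] /mnmP/(_ i); rewrite mnmDE mnm1E mi0 eqxx.
by rewrite -[in LHS](@submK _ U_(i) m) ?lep1mP // addmC mcoeffMX.
Qed.

Lemma mcoeffX_deriv i p m : ('X_i * p^`M(i))@_m = p@_m *+ m i.
Proof.
rewrite mcoeffXUM; case: eqP => [->|/eqP mi]; first by rewrite mulr0n.
rewrite mcoeff_deriv submK ?lep1mP // mnmBE mnm1E eqxx subn1 prednK //.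
by rewrite lt0n.
Qed.

Lemma euler_identity d p :
  p \is d.-homog -> \sum_i 'X_i * p^`M(i) = p *+ d.
Proof.
move=> /dhomogP hp; apply/mpolyP => m; rewrite raddf_sum /= mcoeffMn.
under eq_bigr => i _ do rewrite mcoeffX_deriv.
rewrite sumrMnr -mdegE.
have [/hp <-//|] := boolP (m \in msupp p).
by rewrite -mcoeff_eq0 => /eqP ->; rewrite !mul0rn.
Qed.

(* The monomial ideal generated by the X_i ^+ a. *)
Definition box_ideal (a : nat) p := forall m, (forall i, m i < a)%N -> p@_m = 0.

Lemma box_ideal0 a : box_ideal a 0.
Proof. by move=> m _; rewrite mcoeff0. Qed.

Lemma box_idealD a p q : box_ideal a p -> box_ideal a q -> box_ideal a (p + q).
Proof. by move=> hp hq m hm; rewrite mcoeffD hp ?hq ?addr0. Qed.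

Lemma box_idealZ a c p : box_ideal a p -> box_ideal a (c *: p).
Proof. by move=> hp m hm; rewrite mcoeffZ hp ?mulr0. Qed.

Lemma box_ideal_sum a (I : finType) (F : I -> {mpoly K[N]}) :
  (forall t, box_ideal a (F t)) -> box_ideal a (\sum_t F t).
Proof. by move=> hF m hm; rewrite raddf_sum big1 // => t _; apply: hF. Qed.

Lemma box_idealXM a i p : box_ideal a p -> box_ideal a ('X_i * p).
Proof.
move=> hp m hm; rewrite mcoeffXUM; case: eqP => // _; apply: hp => j.
by rewrite mnmBE (leq_ltn_trans (leq_subr _ _)).
Qed.

(** Pigeonhole: a monomial whose [N] exponents are all below [a] has degree at most N (a - 1). *)
Lemma box_ideal_dhomog a d p :
  p \is d.-homog -> (N * a.-1 < d)%N -> box_ideal a p.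
Proof.
move=> /dhomogP hp hd m hm; apply/eqP; rewrite mcoeff_eq0.
apply/negP => /hp; apply/eqP; rewrite neq_ltn; apply/orP; left.
apply: leq_ltn_trans hd; rewrite [mf in mf m]/= mdegE.
rewrite -[X in (_ <= X)%N](_ : \sum_(i < N) a.-1 = _)%N; last first.
  by rewrite sum_nat_const card_ord.
by apply: leq_sum => i _; case: a hm => [|a] /(_ i).
Qed.

Lemma box_ideal_decomp a k p : p \is (a + k).-homog -> box_ideal a p ->
  exists g : 'I_N -> {mpoly K[N]},
    (forall i, g i \is k.-homog) /\ p = \sum_i 'X_i ^+ a * g i.
Proof.
move=> /dhomogP hp hI.
have hm m : m \in msupp p -> exists g : 'I_N -> {mpoly K[N]},
    (forall i, g i \is k.-homog) /\ p@_m *: 'X_[m] = \sum_i 'X_i ^+ a * g i.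
  move=> hm; have /existsP [i hi] : [exists i, (a <= m i)%N].
    apply: contraLR hm; rewrite negb_exists => /forallP h.
    by rewrite -mcoeff_eq0 hI // => i; rewrite ltnNge.
  exists (fun j => if j == i then p@_m *: 'X_[m - U_(i) *+ a] else 0); split.
    move=> j; case: ifP => _; last exact: dhomog0.
    have hle : (U_(i) *+ a <= m)%MM.
      apply/mnm_lepP => l; rewrite mulmnE mnm1E; case: eqP => [<-|//].
      by rewrite mul1n.
    rewrite dhomogZ // dhomogX; move: (hp _ hm) => /=.
    rewrite -{1}(submK hle) mdegD mdegMn mdeg1 mul1n addnC.
    by move/addnI => ->.
  rewrite (bigD1 i) //= eqxx big1 ?addr0; last first.
    by move=> j /negPf ->; rewrite mulr0.
  rewrite -scalerAr mpolyXn -mpolyXD addmC submK //.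
  apply/mnm_lepP => l; rewrite mulmnE mnm1E; case: eqP => [<-|//].
  by rewrite mul1n.
(* Each monomial is charged to one variable of exponent at least [a]. The induction is on a list
   included in [msupp p], so that its tail still qualifies. *)
have: {subset msupp p <= msupp p} by [].
rewrite [X in exists g, _ /\ X = _]mpolyE.
elim: {1 3}(msupp p) => [|m s IH] hs.
  exists (fun=> 0); split; first by move=> i; apply: dhomog0.
  by rewrite big_nil big1 // => i _; rewrite mulr0.
have [g1 [hg1 e1]] := hm m (hs m (mem_head _ _)).
have [|g2 [hg2 e2]] := IH; first by move=> x hx; apply: hs; rewrite inE hx orbT.
exists (fun i => g1 i + g2 i); split; first by move=> i; apply: dhomogD.
by rewrite big_cons e1 e2 -big_split /=; apply: eq_bigr => i _; rewrite mulrDr.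
Qed.

(** * The sl2 action and the strong Lefschetz property *)

Definition ell : {mpoly K[N]} := \sum_i 'X_i.

Lemma ell_dhomog : ell \is 1.-homog.
Proof. by apply: rpred_sum => i _; rewrite dhomogX /= mdeg1. Qed.

(* The sl2 lowering operator: X_i^e is sent to e (a - e) X_i^(e-1) in each
   variable, so it preserves the ideal of the X_i^a. *)
Definition lower (a : nat) p : {mpoly K[N]} :=
  \sum_i (p *+ a - 'X_i * p^`M(i))^`M(i).

Lemma mcoeff_lower a p m : (lower a p)@_m =
  \sum_i p@_(m + U_(i)) * ((a%:R - (m i).+1%:R) * (m i).+1%:R).
Proof.
rewrite raddf_sum; apply: eq_bigr => i _ /=.
rewrite mcoeff_deriv mcoeffB mcoeffMn mcoeffX_deriv mnmDE mnm1E eqxx addn1.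
ring.
Qed.

Lemma lowerZ a c p : lower a (c *: p) = c *: lower a p.
Proof.
apply/mpolyP => m; rewrite mcoeffZ !mcoeff_lower mulr_sumr.
by apply: eq_bigr => i _; rewrite mcoeffZ -mulrA.
Qed.

Lemma lowerB a p q : lower a (p - q) = lower a p - lower a q.
Proof.
apply/mpolyP => m; rewrite mcoeffB !mcoeff_lower -sumrB.
by apply: eq_bigr => i _; rewrite mcoeffB mulrBl.
Qed.

Lemma lower_dhomog a d p : p \is d.+1.-homog -> lower a p \is d.-homog.
Proof.
move=> /dhomogP hp; apply/dhomogP => m; apply: contraTeq => hm.
rewrite -mcoeff_eq0 mcoeff_lower big1 // => i _.
have [/hp|] := boolP (m + U_(i) \in msupp p)%MM.
  by move=> /=; rewrite mdegD mdeg1 addn1 => -[] e; rewrite /= e eqxx in hm.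
by rewrite -mcoeff_eq0 => /eqP ->; rewrite mul0r.
Qed.

(** Adding [U_(i)] to [m] leaves the box only if m_i + 1 = a, and exactly then the factor a - (m_i +
    1) vanishes. *)
Lemma box_ideal_lower a p : box_ideal a p -> box_ideal a (lower a p).
Proof.
move=> hp m hm; rewrite mcoeff_lower big1 // => i _.
have [<-|ne] := eqVneq a (m i).+1; first by rewrite subrr mul0r mulr0.
rewrite hp ?mul0r // => j; rewrite mnmDE mnm1E; case: eqP => [<-|_].
  by rewrite addn1 ltn_neqAle eq_sym ne hm.
by rewrite addn0.
Qed.

Lemma lower_ell a p : ell * lower a p - lower a (ell * p) =
  (\sum_i 'X_i * p^`M(i)) *+ 2 - p *+ (N * a) + p *+ N.
Proof.
have key i j : 'X_j * (p *+ a - 'X_i * p^`M(i))^`M(i)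
     - (('X_j * p) *+ a - 'X_i * ('X_j * p)^`M(i))^`M(i)
   = (j == i)%:R * (('X_i * p^`M(i)) *+ 2 - p *+ a + p).
  have subUU : (U_(i) - U_(i) = 0)%MM.
    by apply/mnmP => l; rewrite mnmBE mnm0E subnn.
  apply: (derivation_commutator _ (mderiv i) (mderivM i)) => /=.
  - rewrite mderivX mnm1E; case: eqP => [->|_]; last by rewrite scale0r.
    by rewrite subUU mpolyX0 scale1r.
  - by rewrite mderivX mnm1E eqxx subUU mpolyX0 scale1r.
  - by case: (j == i); rewrite -mpolyC_nat mderivC.
have lin : lower a (ell * p) =
    \sum_j \sum_i (('X_j * p) *+ a - 'X_i * ('X_j * p)^`M(i))^`M(i).
  rewrite exchange_big /=; apply: eq_bigr => i _.
  by rewrite /ell mulr_suml -sumrMnl raddf_sum mulr_sumr -sumrB raddf_sum.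
rewrite lin /lower mulr_suml -sumrB.
under eq_bigr => j _ do rewrite mulr_sumr -sumrB.
rewrite exchange_big /=.
under eq_bigr => i _.
  under eq_bigr => j _ do rewrite key.
  rewrite (bigD1 i) //= eqxx mul1r big1 ?addr0; last first.
    by move=> j /negPf ->; rewrite mul0r.
  over.
rewrite big_split sumrB sumrMnl !sumr_const card_ord -mulrnA.
by rewrite [(a * N)%N]mulnC.
Qed.

Lemma box_ideal_ellXM a r p :
  box_ideal a p -> box_ideal a (ell ^+ r * p).
Proof.
elim: r => [|r IH] hp; first by rewrite expr0 mul1r.
rewrite exprS -mulrA mulr_suml; apply: box_ideal_sum => i.
exact/box_idealXM/IH.
Qed.

Lemma iter_lower_dhomog a t d p :
  p \is (d + t).-homog -> iter t (lower a) p \is d.-homog.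
Proof.
elim: t d => [|t IH] d hp /=; first by rewrite addn0 in hp.
by apply/lower_dhomog/IH; rewrite addSnnS.
Qed.

(** The weight 2d - N b is formed in [K] because it is negative below the middle degree. *)
Lemma lower_ell_dhomog b d p : p \is d.-homog ->
  ell * lower b.+1 p
  = lower b.+1 (ell * p) + (d.*2%:R - (N * b)%:R) *: p.
Proof.
move=> hp; apply/eqP; rewrite addrC -subr_eq lower_ell (euler_identity d) //.
rewrite scalerBl !scaler_nat -mulrnA muln2 mulnS addnC mulrnDr opprD.
by rewrite addrA subrK.
Qed.

(** Moving [ell] past t + 1 copies of [lower] adds up the weights 2(d + i) - N b for i = 0, ..., t;
    the remaining term comes from [ell * v] and lies in the ideal. *)
Lemma ell_iter_lower b d t v : v \is (d + t).-homog ->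
  box_ideal b.+1 (ell * v) ->
  box_ideal b.+1 (ell * iter t.+1 (lower b.+1) v
    - (t.+1%:R * ((d + t).*2%:R - (N * b)%:R - t%:R))
        *: iter t (lower b.+1) v).
Proof.
set F := lower b.+1; set I := box_ideal b.+1 => hv hEv.
elim: t d hv => [|t IH] d hv.
  rewrite /= (lower_ell_dhomog _ _ _ hv) mul1r subr0 addrK.
  exact: box_ideal_lower.
move: (hv); rewrite -addSnnS => /IH; set w := _%:R - _%:R => hI.
rewrite [iter t.+2 _ _]iterS.
rewrite (lower_ell_dhomog _ d) -/F; last exact: iter_lower_dhomog.
(* The new weight is (t + 2)(w - t - 1) - (t + 1)(w - t), which leaves [F] applied to the induction
   hypothesis. *)
have -> : F (ell * iter t.+1 F v) + (d.*2%:R - (N * b)%:R) *: iter t.+1 F v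
   - (t.+2%:R * (w - t.+1%:R)) *: iter t.+1 F v
   = F (ell * iter t.+1 F v - (t.+1%:R * (w - t%:R)) *: iter t F v).
  rewrite [in RHS]/F lowerB lowerZ -/F -[F (iter t F v)]iterS.
  rewrite -addrA -scalerBl -scaleNr.
  congr (_ + _ *: _); rewrite /w -!mul2n.
  rewrite !natrM !natrD -!natr1; ring.
exact: box_ideal_lower.
Qed.

Hypothesis charK0 : [pchar K] =i pred0.

(** The scalar is the product over t < r of (t + 1)(2(d + r) - N b - t). The bound on [r] makes
    every factor a positive integer, hence nonzero in characteristic 0. *)
Lemma ellX_iter_lower b d r v : v \is (d + r).-homog ->
  box_ideal b.+1 (ell * v) -> (r + N * b <= (d + r).*2)%N ->
  exists2 c, c != 0 & box_ideal b.+1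
    (ell ^+ r * iter r (lower b.+1) v - c *: v).
Proof.
elim: r d => [|r IH] d hv hEv hr.
  exists 1; rewrite ?oner_eq0 // expr0 mul1r scale1r subrr.
  exact: box_ideal0.
have := hv; rewrite -addSnnS => hv'.
have [|c nzc hc] := IH _ hv' hEv; first by lia.
pose c' : K := r.+1%:R * ((d.+1 + r).*2%:R - (N * b)%:R - r%:R).
exists (c' * c).
  have -> : c' = (r.+1 * ((d.+1 + r).*2 - N * b - r))%:R.
    by rewrite natrM !natrB //; lia.
  rewrite mulf_eq0 (negPf nzc) orbF (proj1 (pcharf0P K) charK0) muln_eq0; lia.
rewrite exprSr -mulrA.
have -> : ell ^+ r * (ell * iter r.+1 (lower b.+1) v) - (c' * c) *: v
  = ell ^+ r * (ell * iter r.+1 (lower b.+1) v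
      - c' *: iter r (lower b.+1) v)
    + c' *: (ell ^+ r * iter r (lower b.+1) v - c *: v).
  by rewrite mulrBr scalerBr scalerA -scalerAr addrA subrK.
apply: box_idealD; last exact: box_idealZ.
by apply/box_ideal_ellXM/ell_iter_lower.
Qed.

(** The bound says that the source degree d and the target degree d + r add up to at least the socle
    degree N b, the range where ell^r is onto. *)
Lemma lefschetz b d r v : v \is (d + r).-homog -> (r + N * b <= (d + r).*2)%N ->
  exists2 z, z \is d.-homog & box_ideal b.+1 (v - ell ^+ r * z).
Proof.
have [q] := ubnP ((N * b).+1 - (d + r)).
elim: q d r v => // q IH d r v hq hv hr.
have [hlt|hge] := ltnP (N * b) (d + r).
  exists 0; first exact: dhomog0.
  by rewrite mulr0 subr0; apply: (box_ideal_dhomog _ (d + r)).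
have hell p e : p \is e.-homog -> ell * p \is e.+1.-homog.
  by move=> hp; rewrite -add1n; apply: dhomogM => //; apply: ell_dhomog.
have hellX p e t : p \is e.-homog -> ell ^+ t * p \is (e + t).-homog.
  move=> hp; elim: t => [|t IHt]; first by rewrite expr0 mul1r addn0.
  by rewrite exprS -mulrA addnS; apply: hell.
(* Raising [r] while keeping [d] preserves the bound and moves the target degree up. *)
have [||| z hz hI] := IH d r.+1 (ell * v).
- by lia.
- by rewrite addnS; apply: hell.
- by lia.
set u := v - ell ^+ r * z.
have hu : u \is (d + r).-homog by apply: rpredB => //; apply: hellX.
have [||c nzc hc] := ellX_iter_lower b d r u hu => //.
  by rewrite mulrBr mulrA -exprS.
set y := iter r _ u in hc.
(* Modulo the ideal, [ell] kills [u], so ell^r y = c u and [u] is itself a multiple of ell^r. *)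
exists (z + c^-1 *: y).
  by apply: dhomogD => //; apply/dhomogZ/iter_lower_dhomog.
have -> : v - ell ^+ r * (z + c^-1 *: y)
    = - c^-1 *: (ell ^+ r * y - c *: u).
  rewrite scalerBr !scaleNr scalerA mulVf // scale1r mulrDr opprD -scalerAr.
  by rewrite opprK addrA addrC.
exact: box_idealZ.
Qed.

End Lefschetz.

(** * Points of projective space as lines *)

Section ProjectivePoints.
Variables (K : fieldType) (V : vectType K).

Definition line_point (v : V) (hv : v != 0) : proj V.
Proof. by exists <[v]>%VS; rewrite dim_vline hv. Defined.

Lemma val_proj_line (p : proj V) : val p = <[vpick (val p)]>%VS.
Proof.
apply/eqP; rewrite eq_sym eqEdim -memvE memv_pick (eqP (valP p)) dim_vline.
by rewrite vpick0 -dimv_eq0 (eqP (valP p)).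
Qed.

End ProjectivePoints.

(** * Linear subspaces and a lower bound for the dimension *)

Section LinearChain.
Local Open Scope classical_set_scope.
Variables (K : closedFieldType) (V : vectType K).
Implicit Types (u v w : V) (Z : set (proj V)).

Lemma meval_dhomogZ N e (f : {mpoly K[N]}) (c : K) (x : 'I_N -> K) :
  f \is e.-homog -> f.@[fun i => c * x i] = c ^+ e * f.@[x].
Proof.
move=> /dhomogP hf; rewrite !mevalE big_distrr /=.
rewrite big_seq [RHS]big_seq; apply: eq_bigr => m /hf /= <-.
rewrite mulrCA mdegE -prodrXr -big_split /=; congr (_ * _).
by apply: eq_bigr => i _; rewrite exprMn.
Qed.

Lemma peval_line (f : {mpoly K[\dim {:V}]}) v w : exists q : {poly K},
  forall t, q.[t] = peval f (v + t *: w).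
Proof.
pose b := vbasis {:V}.
exists (mmap polyC (fun i => (coord b i v)%:P + coord b i w *: 'X) f) => t.
rewrite /peval mevalE /mmap horner_sum; apply: eq_bigr => m _.
rewrite hornerM hornerC /mmap1 horner_prod; congr (_ * _).
apply: eq_bigr => i _; rewrite horner_exp hornerD hornerC hornerZ hornerX.
by rewrite linearD linearZ mulrC.
Qed.

Lemma not_in_zclosed Z p : zclosed Z -> ~ Z p ->
  exists f v, [/\ v != 0, v \in val p, peval f v != 0 &
    forall q u, Z q -> u \in val q -> peval f u = 0].
Proof.
move=> [S [hS ->]] /existsNP [f] /not_implyP [Sf].
move=> /existsNP [w] /not_implyP [wp].
move=> /eqP fw; have [e hf] := hS f Sf.
set v := vpick (val p); have def_p : val p = <[v]>%VS := val_proj_line _ _ p.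
have nzv : v != 0.
  by apply: contraTneq (valP p) => v0; rewrite def_p v0 dim_vline eqxx.
exists f, v; split => //; first by rewrite def_p memv_line.
  move: wp fw; rewrite def_p => /vlineP [c ->]; rewrite /peval.
  under meval_eq do rewrite linearZ.
  by rewrite (meval_dhomogZ _ e) // mulf_eq0 negb_or => /andP [].
by move=> q u hq hu; apply: hq.
Qed.

Definition linear_locus (P : V -> Prop) : set (proj V) :=
  [set p : proj V | forall v, v \in val p -> P v].

Lemma linear_locus_point (P : V -> Prop) v (hv : v != 0) :
  (forall c w, P w -> P (c *: w)) ->
  linear_locus P (line_point _ _ v hv) <-> P v.
Proof.
move=> hP; split=> [|Pv w /vlineP [c ->]]; last exact: hP.
by apply; apply: memv_line.
Qed.

(** If neither closed set contains the subspace, two polynomials vanish on one set each but not at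
    [v], respectively [w]. On the line through [v] and [w] they become nonzero polynomials in one
    variable, so some point of it avoids both sets. *)
Lemma linear_locus_irreducible (P : V -> Prop) :
  (forall u v, P u -> P v -> P (u + v)) -> (forall c v, P v -> P (c *: v)) ->
  (exists2 v, v != 0 & P v) -> zirreducible (linear_locus P).
Proof.
move=> PD PZ [v0 nzv0 Pv0]; split.
  by exists (line_point _ _ v0 nzv0); apply/linear_locus_point.
move=> Z1 Z2 cl1 cl2 hZ; apply: contrapT => /not_orP [].
move=> /existsNP [p] /not_implyP [hp] /(not_in_zclosed _ _ cl1).
move=> [f [v [nzv vp fv fZ1]]].
move=> /existsNP [q] /not_implyP [hq] /(not_in_zclosed _ _ cl2).
move=> [g [w [nzw wq gw gZ2]]].
(* A third polynomial, a coordinate nonzero at [v], keeps the chosen vector of the line away from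
   0. *)
have [i nzi] : exists i, coord (vbasis {:V}) i v != 0.
  apply: contrapT => /forallNP h; move/eqP: nzv; apply.
  rewrite (coord_vbasis (memvf v)) big1 // => i _.
  by have /negP := h i; rewrite negbK => /eqP ->; rewrite scale0r.
have [F hF] := peval_line f v (w - v); have [G hG] := peval_line g v (w - v).
have [H hH] := peval_line 'X_i v (w - v).
have nzF : F != 0.
  apply: contraNneq fv => F0; move: (hF 0).
  by rewrite F0 horner0 scale0r addr0 => <-.
have nzG : G != 0.
  apply: contraNneq gw => G0; move: (hG 1).
  by rewrite G0 horner0 scale1r addrC subrK => <-.
have nzH : H != 0.
  apply: contraNneq nzi => H0; move: (hH 0).
  by rewrite H0 horner0 scale0r addr0 /peval mevalXU => <-.
have /closed_nonrootP [t] : F * G * H != 0 by rewrite !mulf_neq0.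
rewrite /root !hornerM hF hG hH !mulf_eq0 !negb_or -andbA.
set u := v + _ => /and3P [fu gu hu].
have nzu : u != 0.
  by apply: contraNneq hu => ->; rewrite /peval mevalXU linear0.
have /hZ [/fZ1 h|/gZ2 h] : linear_locus P (line_point _ _ u nzu).
- apply/linear_locus_point => //; apply: (PD); first exact: hp.
  by apply: (PZ); apply: (PD); [apply: hq | rewrite -scaleN1r; apply/PZ/hp].
- by move: fu; rewrite h ?eqxx // memv_line.
- by move: gu; rewrite h ?eqxx // memv_line.
Qed.

(** For i < dim V this is a linear subspace of projective dimension i. *)
Definition flag_locus (i : nat) : set (proj V) :=
  linear_locus (fun v => forall j : 'I_(\dim {:V}), (i < j)%N ->
    coord (vbasis {:V}) j v = 0).

Lemma flag_locus_closed i : zclosed (flag_locus i).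
Proof.
exists [set f | exists2 j : 'I_(\dim {:V}), (i < j)%N & f = 'X_j]; split.
  by move=> f [j _ ->]; exists 1%N; rewrite dhomogX /= mdeg1.
apply/seteqP; split => [p hp f [j ij ->] v vp|p hp v vp j ij].
  by rewrite /peval mevalXU; apply: hp.
have := hp 'X_j (ex_intro2 _ _ j ij erefl) v vp.
by rewrite /peval mevalXU.
Qed.

Lemma coord_vbasisE (i j : 'I_(\dim {:V})) :
  coord (vbasis {:V}) j (vbasis {:V})`_i = (i == j)%:R.
Proof. exact: coord_free (basis_free (vbasisP _)). Qed.

Lemma vbasis_neq0 (i : 'I_(\dim {:V})) : (vbasis {:V})`_i != 0.
Proof.
apply/eqP => b0; have := coord_vbasisE i i.
by rewrite b0 linear0 eqxx => /esym/eqP; rewrite oner_eq0.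
Qed.

Lemma flag_locus_chain :
  (0 < \dim {:V})%N -> irreducible_chain setT (\dim {:V}).-1 flag_locus.
Proof.
move=> dim_gt0; split=> i hi.
  split=> //; first exact: flag_locus_closed.
  apply: linear_locus_irreducible.
  - by move=> u v hu hv j ij; rewrite linearD /= hu ?hv ?addr0.
  - by move=> c v hv j ij; rewrite linearZ /= hv ?mulr0.
  - exists (vbasis {:V})`_(Ordinal dim_gt0); first exact: vbasis_neq0.
    by move=> j ij; rewrite coord_vbasisE -val_eqE /=; case: (val j) ij.
split=> [p hp v vp j ij|]; first by apply: hp => //; apply: ltnW.
have hi' : (i.+1 < \dim {:V})%N by lia.
(* The basis vector of index i + 1 shows that the inclusion is strict. *)
set b := Ordinal hi'.
have sc k c w :
  (forall j : 'I_(\dim {:V}), (k < j)%N -> coord (vbasis {:V}) j w = 0) ->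
  forall j : 'I_(\dim {:V}), (k < j)%N -> coord (vbasis {:V}) j (c *: w) = 0.
  by move=> hw j kj; rewrite linearZ /= hw ?mulr0.
move=> /(_ (line_point _ _ _ (vbasis_neq0 b))) h.
have /h : flag_locus i.+1 (line_point _ _ _ (vbasis_neq0 b)).
  apply/linear_locus_point; first exact: sc.
  move=> j ij; rewrite coord_vbasisE -val_eqE /=.
  by case: eqP ij => // ->; rewrite ltnn.
move/linear_locus_point => /(_ (sc i)) /(_ b (ltnSn i)) /eqP.
by rewrite coord_vbasisE eqxx oner_eq0.
Qed.

Lemma setT_not_dim_lt m : (0 < \dim {:V})%N -> (m <= (\dim {:V}).-1)%N ->
  ~ dim_lt [set: proj V] m.
Proof.
move=> dim_gt0 hm /(_ _ _ (flag_locus_chain dim_gt0)).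
by rewrite ltnNge hm.
Qed.

End LinearChain.

(** * Decompositions of forms and the secant variety *)

Lemma dim_dhomog (K : fieldType) (n d : nat) :
  \dim {:dhomog n.+1 K d} = 'C(n + d, n).
Proof.
by rewrite dimvf -[RHS]bin_sub ?leq_addr // addKn addnC.
Qed.

Lemma osculating_secant_setT (K : fieldType) (k n d s : nat)
    (L : 'I_s -> dhomog n.+1 K 1) : (k <= d)%N -> (forall i, L i != 0) ->
  (forall G : dhomog n.+1 K d, exists g : 'I_s -> dhomog n.+1 K k,
    (G : {mpoly K[n.+1]}) =
      \sum_i (L i : {mpoly K[n.+1]}) ^+ (d - k) * (g i : {mpoly K[n.+1]})) ->
  osculating_secant K k n d s = [set: proj (dhomog n.+1 K d)]%classic.
Proof.
(* A closed [Z] containing the union of secant spaces contains [p] as soon as [p] lies on one of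
   them. *)
move=> kd nzL hG; apply/seteqP; split=> // p _ Z [_]; apply.
set G := vpick (val p).
have [g def_G] := hG G.
have hF0 : ('X_ord0 ^+ k : {mpoly K[n.+1]}) \is k.-homog.
  by rewrite mpolyXn dhomogX /= mdegMn mdeg1 mul1n.
have nzF0 : DHomog hF0 != 0.
  by rewrite -val_eqE /= expf_neq0 // -msupp_eq0 msuppX.
(* Points of [osculating] need a nonzero cofactor: X_0^k replaces a zero [g i], whose component in
   the sum stays 0. *)
pose F i := if g i == 0 then DHomog hF0 else g i.
have nzF i : F i != 0 by rewrite /F; case: ifPn.
have hH (f : dhomog n.+1 K k) i :
    (L i : {mpoly K[n.+1]}) ^+ (d - k) * f \is d.-homog.
  rewrite -[X in X.-homog](subnK kd) -[X in (X + _)%N]mul1n.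
  apply: dhomogM; last exact: (valP f).
  by apply: dhomogMn; apply: (valP (L i)).
have nzH i : DHomog (hH (F i) i) != 0.
  rewrite -val_eqE /= mulf_neq0 // ?expf_neq0 //.
    exact: (nzL i).
  exact: (nzF i).
exists (fun i => line_point _ _ _ (nzH i)); split.
  by move=> i; exists (L i), (F i), (DHomog (hH (F i) i)).
rewrite [val p]val_proj_line -/G -memvE; apply/memv_sumP.
exists (fun i => DHomog (hH (g i) i)).
  move=> i _; rewrite /F /=; case: eqP => [g0|_]; last exact: memv_line.
  rewrite (_ : DHomog _ = 0) ?mem0v //; apply/val_inj => /=.
  by rewrite g0 mulr0.
by apply/val_inj; rewrite /= def_G raddf_sum.
Qed.

Lemma ell_neq0 (K : fieldType) (n : nat) : ell K n.+1 != 0.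
Proof.
apply/eqP => /(congr1 (fun p => p@_U_(ord0))%MM)/eqP.
rewrite mcoeff0 raddf_sum (bigD1 ord0) //= mcoeffXU eqxx.
rewrite big1 ?addr0 ?oner_eq0 //.
by move=> i /negPf ne; rewrite mcoeffXU ne.
Qed.

Theorem lemma3p2 (K : closedFieldType) (charK0 : [pchar K] =i pred0)
    (n k d s j : nat) (hn : (1 <= n)%N) (hd : (maxn k 1 <= d)%N)
    (hs : (n + 1 <= s)%N)
    (hj : j = if (n + 2 <= s)%N then 2%N else 1%N)
    (hdk : d%:R < k%:R + 1 + j%:R * ((k%:R + 1) / n%:R) :> rat) :
  ~ defective K k n d s /\
  osculating_secant K k n d s = [set: proj (dhomog n.+1 K d)]%classic.
Proof.
have kd : (k <= d)%N by lia.
have {}hdk : (d * n < k.+1 * (n + j))%N.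
  have n0 : (n%:R : rat) != 0 by rewrite pnatr_eq0; lia.
  rewrite -(ltr_nat rat) !natrM natrD -natr1 -ltr_pdivlMr ?ltr0n //.
  by congr (_ < _): hdk; field.
have full : osculating_secant K k n d s = [set: proj (dhomog n.+1 K d)]%classic.
  have hX i : ('X_i : {mpoly K[n.+1]}) \is 1.-homog by rewrite dhomogX /= mdeg1.
  (* All indices from n + 1 on carry [ell]; those beyond n + 1 will get cofactor 0. *)
  pose L i := if (i < n.+1)%N then DHomog (hX (inord i))
              else DHomog (ell_dhomog K n.+1).
  apply: (osculating_secant_setT _ _ _ _ _ (fun i : 'I_s => L i)) => // [i|G].
    rewrite /L -val_eqE; case: ifP => _ /=; last exact: ell_neq0.
    by rewrite -msupp_eq0 msuppX.
  set a := (d - k)%N.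
  have hG : (G : {mpoly K[n.+1]}) \is (k + a).-homog.
    by rewrite subnKC //; apply: (valP G).
  have [z hz hI] : exists2 z : {mpoly K[n.+1]}, z \is k.-homog &
     box_ideal K n.+1 a ((G : {mpoly K[n.+1]}) -
       (if (n + 2 <= s)%N then ell K n.+1 ^+ a * z else 0)).
    have triv : (a = 0 \/ n.+1 * a.-1 < d)%N ->
        box_ideal K n.+1 a (G : {mpoly K[n.+1]}).
      case=> [-> m /(_ ord0)//|]; apply: box_ideal_dhomog; exact: (valP G).
    case: ifP hj => _ ej; last first.
      exists 0; first exact: dhomog0.
      rewrite subr0; apply: triv; rewrite {}ej in hdk.
      (* For j = 1, the bound d n < (k + 1)(n + 1) is equivalent to (n + 1)(d - k - 1) < d over the
         integers. *)
      by case ea : a => [|b]; [left | right => /=]; nia.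
    case ea : a => [|b].
      exists 0; first exact: dhomog0.
      by rewrite mulr0 subr0 -ea; apply: triv; left.
    rewrite -ea; have [|z hz hI] := lefschetz K n.+1 charK0 b k a G hG.
      (* For j = 2 and b = a - 1, the bound d n < (k + 1)(n + 2) is precisely a + (n + 1) b <= 2
         d. *)
      by rewrite {}ej in hdk; nia.
    by exists z => //; rewrite {1}ea.
  have [|g [hg def_G]] := box_ideal_decomp K n.+1 a k _ _ hI.
    apply: rpredB; first by rewrite [(a + k)%N]addnC.
    case: ifP => _; last exact: dhomog0.
    apply: dhomogM => //.
    by have := dhomogMn a (ell_dhomog K n.+1); rewrite mul1n.
  pose g' i := if (i < n.+1)%N then DHomog (hg (inord i))
              else if i == n.+1 then DHomog hz else 0.
  exists (fun i => g' i).
  rewrite -(big_mkord xpredT (fun i => (L i : {mpoly K[n.+1]}) ^+ a * g' i)) /=.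
  rewrite (big_cat_nat (n := n.+1)) //=; last by lia.
  rewrite big_mkord.
  have -> : \sum_(i < n.+1) (L i : {mpoly K[n.+1]}) ^+ a * g' i =
            \sum_i 'X_i ^+ a * g i.
    by apply: eq_bigr => i _; rewrite /L /g' ltn_ord /= inord_val.
  rewrite -def_G; apply/eqP.
  rewrite addrC -subr_eq opprB addrC subrK; apply/eqP.
  case: leqP => hs2; last by rewrite big_geq //; lia.
  rewrite big_ltn; last by lia.
  rewrite big_nat big1 ?addr0 /L /g' ?ltnn ?eqxx // => i /andP [hi _].
  by rewrite ltnNge (ltnW hi) /= gtn_eqF // mulr0.
(* The expected dimension is a minimum with N, and the flag of P^N has length N. *)
split=> //; rewrite /defective full.
apply: setT_not_dim_lt; rewrite dim_dhomog.
  by rewrite bin_gt0 leq_addr.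
by rewrite -subn1 geq_minl.
Qed.
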